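(* Let $n\ge3$ be odd and let $f=a_1x_1^2+\dots+a_nx_n^2$ with $a_i\in\mathbb{F}_q^\times$. Then for every integer $P\ge1$: if $n=3$, $$N(P)=\begin{cases}\frac{q^2-1}{2q}Pq^P+q^P&\text{if }2\mid P,\\ \frac{q^2-1}{2q}Pq^P+\frac{q^2+1}{2q}\,q^P&\text{if }2\nmid P,\end{cases}$$ and if $n\ge5$, $$N(P)=\begin{cases}\frac{q^{n-1}-1}{q^{n-2}-q}\,q^{P(n-2)}-(q-1)\frac{q^{n-2}+1}{q^{n-2}-q}\,q^{\frac{n-1}2P}&\text{if }2\mid P,\\ \frac{q^{n-1}-1}{q^{n-2}-q}\,q^{P(n-2)}-\frac{(q^2-1)q^{(n-3)/2}}{q^{n-2}-q}\,q^{\frac{n-1}2P}&\text{if }2\nmid P.\end{cases}$$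
   Context: $q$ is a power of an odd prime. $N(P)=\#\{\mathbf{x}\in\mathbb{F}_q[t]^n:\deg(x_i)<P\text{ for all }i,\ f(\mathbf{x})=0\}$ (with the convention $\deg 0=-\infty$, so $\mathbf{x}=\mathbf{0}$ is counted). *)

(* Defs.v *)
From mathcomp Require Import all_boot all_order all_algebra.
Set Implicit Arguments. Unset Strict Implicit. Unset Printing Implicit Defensive.
Import GRing.Theory Num.Theory.
Local Open Scope ring_scope.

Definition diag_form (F : fieldType) (n : nat) (a : 'I_n -> F)
  (x : 'I_n -> {poly F}) : {poly F} :=
  \sum_(i < n) (a i)%:P * (x i) ^+ 2.

(* N(P) = #{ x in F[t]^n : deg x_i < P for all i, f(x) = 0 }.
   {poly_P F} is the finite type of polynomials of size <= P,
   i.e. of degree < P (with deg 0 = -oo, so 0 is included). *)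
Definition NP (F : finFieldType) (n : nat) (a : 'I_n -> F) (P : nat) : nat :=
  #|[set x : {ffun 'I_n -> {poly_P F}} |
       diag_form a (fun i => val (x i)) == 0]|.

(* Main.v *)
(** Diagonalisation is avoided: all invertible symmetric [A] of odd size [n = 2m+1]
    are treated together, writing [Q] for the form [x A x^T] and [q = #|F|].

    The vector of coefficients of [t^P] in a zero [x] of [Q] with [deg x_i <= P] is
    isotropic. If it is a given nonzero vector, split off a hyperbolic plane
    containing it, so that [Q = a b + Q'(y)], [a] is monic of degree [P] and [b], [y]
    have degree [< P]; then [b] is determined, and exists iff [a] divides [Q'(y)]. Hence
    [N(P+1) = N(P) + (q^(n-1) - 1) R'(P)], where [R(d)] counts the pairs [(u, y)]
    with [u] monic of degree [d], [deg y_i < d] and [u] dividing [Q(y)].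

    [R] depends only on the dimension. In dimension 1, exchanging [u] with [z^2 / u]
    and reducing [z] modulo the latter expresses [R(d)] through smaller degrees. In
    dimension [n + 2], with [Q = a b + Q'(y)], one Euclidean step on [(u, a)] does the
    same and reduces to [R'] when [a = 0]. The resulting recursions telescope to
    [R(d+1) = q^(2m+1) R(d) + [d odd] (q - 1) q^(m(d+1) + d)]. *)

Require Import Defs.
From mathcomp Require Import all_boot all_order all_algebra all_field.
From mathcomp Require Import ring zify.
Set Implicit Arguments. Unset Strict Implicit. Unset Printing Implicit Defensive.
Import GRing.Theory Num.Theory.
Local Open Scope ring_scope.

Local Notation polyM := (map_mx polyC).

(** * Counting in infinite types *)

Definition has_card (T : eqType) (S : pred T) (k : nat) : Prop :=
  exists s : seq T, [/\ uniq s, s =i S & size s = k].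

Section Cardinals.
Implicit Types T : eqType.

Lemma has_card_unique T (S : pred T) k k' :
  has_card S k -> has_card S k' -> k = k'.
Proof.
move=> [s [us sS <-]] [s' [us' sS' <-]].
by apply/perm_size/uniq_perm => // x; rewrite sS sS'.
Qed.

Lemma has_card_eq T (S S' : pred T) k : S =1 S' -> has_card S k -> has_card S' k.
Proof. by move=> E [s [us sS sk]]; exists s; split=> // x; rewrite sS; apply: E. Qed.

Lemma has_card_fin (T : finType) (S : pred T) : has_card S #|S|.
Proof.
exists (enum S); split; first exact: enum_uniq.
  by move=> x; rewrite mem_enum.
by rewrite cardE.
Qed.

(** The maps need to be mutually inverse only between [S] and [S'], so divisions and inverses may
    take default values elsewhere. *)
Lemma has_card_bij T T' (S : pred T) (S' : pred T') (f : T -> T') (g : T' -> T) k :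
    (forall x, S x -> S' (f x) /\ g (f x) = x) ->
    (forall y, S' y -> S (g y) /\ f (g y) = y) ->
  has_card S k -> has_card S' k.
Proof.
move=> fS gS [s [us sS sk]]; exists (map f s); split; last by rewrite size_map.
  rewrite map_inj_in_uniq // => x y; rewrite !sS => /fS[_ Ex] /fS[_ Ey] E.
  by rewrite -Ex E Ey.
move=> y; apply/mapP/idP => [[x]|S'y].
  by rewrite sS => /fS[S'fx _] ->.
by have [Sgy Ey] := gS y S'y; exists (g y); rewrite // sS.
Qed.

Lemma has_cardX T T' (S : pred T) (S' : pred T') k k' :
  has_card S k -> has_card S' k' -> has_card (fun x => S x.1 && S' x.2) (k * k').
Proof.
move=> [s [us sS sk]] [s' [us' sS' sk']]; exists [seq (x, y) | x <- s, y <- s'].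
split; last by rewrite size_allpairs sk sk'.
  by apply: allpairs_uniq => // -[x y] [x' y'] _ _ [-> ->].
move=> [x y]; rewrite -[RHS]topredE /=; apply/allpairsP/andP.
  by move=> [[x' y'] /= []]; rewrite sS sS' => ? ? [-> ->].
by move=> [Sx S'y]; exists (x, y); rewrite sS sS'.
Qed.

Lemma has_card_partition T (I : eqType) (S : pred T) (pi : T -> I) (w : I -> nat)
    (s : seq I) :
    uniq s -> (forall x, S x -> pi x \in s) ->
    (forall i, i \in s -> has_card (fun x => S x && (pi x == i)) (w i)) ->
  has_card S (\sum_(i <- s) w i).
Proof.
elim: s S => [|i s IHs] S /= us piS cS.
  exists [::]; rewrite big_nil; split=> // x; apply/esym/negP.
  by move/piS; rewrite in_nil.
move: us => /andP[is_ us]; rewrite big_cons.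
have [r [ur rS sr]] : has_card (fun x => S x && (pi x == i)) (w i).
  by apply: cS; rewrite mem_head.
have [|j js|r' [ur' rS' sr']] := IHs (fun x => S x && (pi x != i)) us.
- by move=> x /andP[/piS]; rewrite inE => /orP[/eqP->|//]; rewrite eqxx.
- apply: has_card_eq (cS j _) => [x /=|]; last by rewrite inE js orbT.
  case: (pi x =P j) => [->|]; rewrite ?andbF // !andbT.
  by case: eqP is_ => [<-|_ _]; rewrite ?js ?andbT.
exists (r ++ r'); split; last by rewrite size_cat sr sr'.
  rewrite cat_uniq ur ur' andbT; apply/hasPn => x; rewrite rS' rS /= -!topredE /=.
  by move=> /andP[_ /negPf->]; rewrite andbF.
move=> x; rewrite mem_cat rS rS' -!topredE /=.
by case: (S x); case: (pi x == i).
Qed.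

Lemma has_card_fibration T (I : eqType) (S : pred T) (B : pred I) (pi : T -> I) k c :
    has_card B k -> (forall x, S x -> B (pi x)) ->
    (forall i, B i -> has_card (fun x => S x && (pi x == i)) c) ->
  has_card S (k * c).
Proof.
move=> [s [us sB <-]] piS cS.
have := @has_card_partition T I S pi (fun=> c) s us.
rewrite big_const_seq count_predT iter_addn_0 mulnC; apply.
- by move=> x /piS; rewrite sB.
- by move=> i; rewrite sB => /cS.
Qed.

Lemma has_card_split T (S C : pred T) k k' :
    has_card (fun x => S x && C x) k -> has_card (fun x => S x && ~~ C x) k' ->
  has_card S (k + k').
Proof.
move=> ck ck'.
have -> : (k + k')%N = \sum_(b <- [:: true; false]) (if b then k else k').
  by rewrite big_cons big_seq1.
apply: (@has_card_partition _ _ _ C) => // [x _|b _]; first by case: (C x).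
by case: b; [move: ck | move: ck']; apply: has_card_eq => x; case: (C x).
Qed.

Lemma has_card_sum T (S : pred T) (pi : T -> nat) (w : nat -> nat) d :
    (forall x, S x -> (pi x < d)%N) ->
    (forall i, (i < d)%N -> has_card (fun x => S x && (pi x == i)) (w i)) ->
  has_card S (\sum_(i < d) w i).
Proof.
move=> piS cS; rewrite -(big_mkord xpredT w).
apply: (@has_card_partition _ _ _ pi); first exact: iota_uniq.
- by move=> x /piS; rewrite mem_index_iota.
- by move=> i; rewrite mem_index_iota => /cS.
Qed.

End Cardinals.

(** * Quadratic forms over a finite field of odd order *)

Definition bform (R : pzSemiRingType) n (A : 'M[R]_n) (x y : 'rV[R]_n) : R :=
  (x *m A *m y^T) 0 0.

Definition qform (R : pzSemiRingType) n (A : 'M[R]_n) (x : 'rV[R]_n) : R := bform A x x.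

Section Forms.
Variables (R : comPzRingType) (n : nat) (A : 'M[R]_n).
Implicit Types x y z : 'rV[R]_n.

Lemma bformDl x y z : bform A (x + y) z = bform A x z + bform A y z.
Proof. by rewrite /bform !mulmxDl mxE. Qed.

Lemma bformDr x y z : bform A x (y + z) = bform A x y + bform A x z.
Proof. by rewrite /bform linearD mulmxDr mxE. Qed.

Lemma bformZl c x z : bform A (c *: x) z = c * bform A x z.
Proof. by rewrite /bform -!scalemxAl mxE. Qed.

Lemma bformZr c x z : bform A x (c *: z) = c * bform A x z.
Proof. by rewrite /bform linearZ -!scalemxAr mxE. Qed.

Lemma bform0l z : bform A 0 z = 0.
Proof. by rewrite /bform !mul0mx mxE. Qed.

Lemma bform0r z : bform A z 0 = 0.
Proof. by rewrite /bform trmx0 mulmx0 mxE. Qed.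

Lemma bformC x y : A^T = A -> bform A x y = bform A y x.
Proof.
move=> sA; transitivity ((x *m A *m y^T)^T 0 0); first by rewrite mxE.
by rewrite /bform !trmx_mul trmxK sA mulmxA.
Qed.

Lemma qform_sum x : qform A x = \sum_j \sum_i x 0 i * A i j * x 0 j.
Proof.
rewrite /qform /bform mxE; apply: eq_bigr => j _; rewrite !mxE mulr_suml.
by apply: eq_bigr.
Qed.

Lemma qform_mul m (B : 'M[R]_(m, n)) (x : 'rV[R]_m) :
  qform A (x *m B) = qform (B *m A *m B^T) x.
Proof. by rewrite /qform /bform trmx_mul !mulmxA. Qed.

End Forms.

(** * Isotropic vectors in dimension at least 3 *)

Section Squares.
Variables (F : finFieldType).
Hypothesis F_odd : odd #|F|.

Lemma two_neq0 : 2%:R != 0 :> F.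
Proof.
apply/negP => F2; have F2c : 2%N \in [pchar F] by rewrite inE F2.
have F1 := finNzRing_gt1 F; move: F_odd F1; rewrite (card_pprimeChar F2c).
by rewrite oddX orbF => /eqP ->.
Qed.

(** Each value has at most the two preimages [t] and [- t], so the image contains at least half of
    the field; equality is excluded because [#|F|] is odd. *)
Lemma card_square_image (al be : F) :
  al != 0 -> (#|F| < 2 * #|[set (al * s ^+ 2 + be)%R | s in F]|)%N.
Proof.
move=> al0; set Im := [set _ | s in F].
suff: (#|F| <= 2 * #|Im|)%N.
  by rewrite leq_eqVlt => /orP[/eqP E|//]; move: F_odd; rewrite E oddM.
rewrite -[#|F|]sum1_card (partition_big_imset (fun s => al * s ^+ 2 + be)) /=.
rewrite [leqRHS]mulnC -[leqRHS]sum_nat_const.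
apply: leq_sum => _ /imsetP[t _ ->]; rewrite sum1_card.
apply: leq_trans (card_size [:: t; - t]); apply: subset_leq_card.
apply/subsetP => s; rewrite unfold_in /= => /eqP.
by move=> /addIr/(mulfI al0)/eqP; rewrite eqf_sqr !inE.
Qed.

(** Pigeonhole: the values of [al * s ^+ 2] and those of [- be * t ^+ 2 - ga] each fill more than
    half of the field, hence share an element. *)
Lemma binary_represents (al be ga : F) : al != 0 -> be != 0 ->
  exists s t : F, al * s ^+ 2 + be * t ^+ 2 + ga = 0.
Proof.
move=> al0 be0.
set X := [set (al * s ^+ 2 + 0)%R | s in F].
set Y := [set (- be * s ^+ 2 - ga)%R | s in F].
have X_ : (#|F| < 2 * #|X|)%N by exact: card_square_image.
have Y_ : (#|F| < 2 * #|Y|)%N by apply: card_square_image; rewrite oppr_eq0.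
have : X :&: Y != set0.
  apply/eqP => XY0; have := cardsUI X Y; rewrite XY0 cards0 addn0 => E.
  have := max_card (X :|: Y); rewrite E => H.
  suff arith a b c : (c < 2 * a -> c < 2 * b -> a + b <= c -> False)%N.
    exact: arith X_ Y_ H.
  by clear; lia.
case/set0Pn => z /setIP[/imsetP[s _ zs] /imsetP[t _ zt]].
exists s, t; have: al * s ^+ 2 + 0 = - be * t ^+ 2 - ga by rewrite -zs -zt.
by rewrite addr0 => /eqP; rewrite -subr_eq0 => /eqP <-; ring.
Qed.

End Squares.

Section Isotropic.
Variables (F : finFieldType).
Hypothesis F_odd : odd #|F|.

Lemma kernel_vector n k (C : 'M[F]_(n, k)) : (k < n)%N ->
  exists2 x : 'rV[F]_n, x != 0 & x *m C = 0.
Proof.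
move=> kn; have : kermx C != 0.
  rewrite -mxrank_eq0 mxrank_ker -lt0n subn_gt0.
  exact: leq_ltn_trans (rank_leq_col C) kn.
case/rowV0Pn => x /sub_kermxP xC x0; by exists x.
Qed.

(** Three nonzero pairwise orthogonal vectors are built by solving linear conditions. If none is
    isotropic, the form is diagonal on their span and [binary_represents] yields a zero. *)
Lemma isotropic_exists n (A : 'M[F]_n) : A^T = A -> (3 <= n)%N ->
  exists2 x : 'rV[F]_n, x != 0 & qform A x = 0.
Proof.
move=> sA n3.
(* A matrix without columns imposes no condition and serves only to produce a nonzero vector. *)
have [x x0 _] : exists2 x : 'rV[F]_n, x != 0 & x *m (0 : 'M_(n, 0)) = 0.
  by apply: kernel_vector; apply: leq_trans n3.
have [qx|qx] := eqVneq (qform A x) 0; first by exists x.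
have [y y0 yx] := kernel_vector (A *m x^T) (ltnW n3).
have [qy|qy] := eqVneq (qform A y) 0; first by exists y.
have [z z0 zxy] := kernel_vector (row_mx (A *m x^T) (A *m y^T)) n3.
have [qz|qz] := eqVneq (qform A z) 0; first by exists z.
move: zxy; rewrite mul_mx_row -row_mx0 => /eq_row_mx[zx zy].
have Byx : bform A y x = 0 by rewrite /bform -mulmxA yx mxE.
have Bzx : bform A z x = 0 by rewrite /bform -mulmxA zx mxE.
have Bzy : bform A z y = 0 by rewrite /bform -mulmxA zy mxE.
have [s [t st]] := binary_represents F_odd (qform A z) qx qy.
(* The coefficient 1 of [z] keeps the vector nonzero: its pairing with [z] is [qform A z]. *)
exists (s *: x + t *: y + z).
  apply: contra_neq qz => /(congr1 (bform A z)).
  by rewrite !bformDr !bformZr Bzx Bzy !mulr0 !add0r bform0r.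
rewrite -[RHS]st /qform !bformDl !bformDr !bformZl !bformZr.
rewrite [bform A x y]bformC // [bform A x z]bformC // [bform A y z]bformC // Byx Bzx Bzy.
by rewrite /qform; ring.
Qed.

End Isotropic.

(** * Hyperbolic planes and their orthogonal complements *)

Definition hrow (R : pzSemiRingType) n (a b : R) (y : 'rV[R]_n) : 'rV[R]_(1 + (1 + n)) :=
  row_mx a%:M (row_mx b%:M y).

Lemma hrow_surj (R : pzSemiRingType) n (x : 'rV[R]_(1 + (1 + n))) :
  x = hrow (lsubmx x 0 0) (lsubmx (rsubmx x) 0 0) (rsubmx (rsubmx x)).
Proof. by rewrite /hrow -!mx11_scalar !hsubmxK. Qed.

Lemma hrow_inj (R : pzSemiRingType) n (a b a' b' : R) (y y' : 'rV[R]_n) :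
  hrow a b y = hrow a' b' y' -> [/\ a = a', b = b' & y = y'].
Proof.
case/eq_row_mx => /(congr1 (fun M : 'M_1 => M 0 0)); rewrite !mxE eqxx !mulr1n => ->.
case/eq_row_mx => /(congr1 (fun M : 'M_1 => M 0 0)); rewrite !mxE eqxx !mulr1n => ->.
by move=> ->.
Qed.

Lemma mul_hrow_col (R : comPzRingType) n m (a b : R) (y : 'rV[R]_n) (x v : 'rV[R]_m) K :
  hrow a b y *m col_mx x (col_mx v K) = a *: x + b *: v + y *m K.
Proof. by rewrite /hrow !mul_row_col !mul_scalar_mx addrA. Qed.

Section Split.
Variables (F : fieldType) (n : nat) (A : 'M[F]_(1 + (1 + n))).
Hypotheses (two0 : 2%:R != 0 :> F) (sA : A^T = A) (uA : A \in unitmx).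

Lemma bform_polyC m (M : 'M[F]_m) x y :
  bform (polyM M) (polyM x) (polyM y) = (bform M x y)%:P.
Proof. by rewrite /bform matrix.map_trmx -!map_mxM mxE. Qed.

(** As [x *m A] is nonzero, some multiple [w] of a unit vector pairs to 1/2 with [x]. Subtracting
    [qform A w *: x] makes it isotropic and, [x] being isotropic, keeps the pairing. The value 1/2
    makes the two cross terms of the form add up to exactly [a * b]. *)
Lemma hyperbolic_partner (x : 'rV[F]_(1 + (1 + n))) : x != 0 -> qform A x = 0 ->
  exists2 v, bform A x v = 2%:R^-1 & qform A v = 0.
Proof.
move=> x0 qx.
have /rV0Pn[j xAj] : x *m A != 0.
  by apply: contra_neq x0 => xA; rewrite -(mulmxK uA x) xA mul0mx.
pose w := ((x *m A) 0 j * 2%:R)^-1 *: delta_mx 0 j : 'rV[F]_(1 + (1 + n)).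
have xw : bform A x w = 2%:R^-1.
  by rewrite bformZr /bform trmx_delta -colE [col _ _ _ _]mxE invfM mulrAC mulVf ?mul1r.
clearbody w; exists (w - qform A w *: x).
  by rewrite -scaleNr bformDr bformZr -/(qform A x) qx mulr0 addr0.
rewrite -scaleNr /qform !bformDl !bformDr !bformZl !bformZr [bform A w x]bformC //.
rewrite -/(qform A x) -/(qform A w) xw qx !mulr0 addr0.
have -> : 2%:R^-1 = 1 - 2%:R^-1 :> F by field.
ring: (mulfV two0).
Qed.

(** The rows of [B] are [x], a hyperbolic partner [v], and a basis [K] of their orthogonal
    complement; [A'] is the Gram matrix of [K]. *)
Lemma hyperbolic_split (x : 'rV[F]_(1 + (1 + n))) : x != 0 -> qform A x = 0 ->
  exists (B : 'M[F]_(1 + (1 + n))) (A' : 'M[F]_n),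
    [/\ B \in unitmx, hrow 1 0 0 *m B = x, A'^T = A', A' \in unitmx &
     forall (a b : {poly F}) y,
       qform (polyM A) (hrow a b y *m polyM B) = a * b + qform (polyM A') y].
Proof.
move=> x0 qx; have [v xv qv] := hyperbolic_partner x0 qx.
have vx : bform A v x = 2%:R^-1 by rewrite bformC.
have xx : bform A x x = 0 := qx.
have vv : bform A v v = 0 := qv.
have h0 : 2%:R^-1 != 0 :> F by rewrite invr_eq0.
pose C := col_mx x v.
(* Orthogonality to [x] and to [v] are independent conditions, so the complement has dimension
   exactly [n]. *)
have fC : row_free (C *m A).
  apply: inj_row_free => w; rewrite mulmxA => /(congr1 (mulmx^~ (invmx A))).
  rewrite mulmxK // mul0mx -[w]hsubmxK [lsubmx _]mx11_scalar [rsubmx _]mx11_scalar.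
  set s := lsubmx w 0 0; set t := rsubmx w 0 0.
  rewrite mul_row_col !mul_scalar_mx => w0.
  have := congr1 (bform A x) w0; have := congr1 (bform A v) w0.
  rewrite !bform0r !bformDr !bformZr xx vv xv vx !mulr0 addr0 add0r.
  move/eqP; rewrite mulf_eq0 (negPf h0) orbF => /eqP->.
  move/eqP; rewrite mulf_eq0 (negPf h0) orbF => /eqP->.
  by rewrite raddf0 row_mx0.
have [K fK KC] : exists2 K : 'M[F]_(n, 1 + (1 + n)), row_free K & K *m (C *m A)^T = 0.
  have : \rank (kermx (C *m A)^T) = n.
    by rewrite mxrank_ker mxrank_tr (eqP fC) addnA addKn.
  have := row_base_free (kermx (C *m A)^T); have := eq_row_base (kermx (C *m A)^T).
  move: (row_base _); move: (\rank _) => r K EK fK rn; subst r.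
  by exists K => //; apply/sub_kermxP; rewrite EK.
have KAx : K *m A *m x^T = 0 /\ K *m A *m v^T = 0.
  move: KC; rewrite trmx_mul sA mulmxA tr_col_mx mul_mx_row -row_mx0.
  by case/eq_row_mx.
have [Kx Kv] := KAx.
pose B := col_mx x (col_mx v K).
(* Pairing a vanishing combination with [v] and with [x] kills the two hyperbolic coordinates;
   freeness of [K] kills the others. *)
have fB (w : 'rV_(1 + (1 + n))) : w *m B = 0 -> w = 0.
  suff H s t y : hrow s t y *m B = 0 -> hrow s t y = 0 by rewrite (hrow_surj w); apply: H.
  rewrite [_ *m B]mul_hrow_col => w0.
  have := congr1 ((bform A)^~ x) w0; have := congr1 ((bform A)^~ v) w0.
  have yK u : K *m A *m u^T = 0 -> bform A (y *m K) u = 0.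
    by move=> Ku; rewrite /bform -!(mulmxA y) Ku mulmx0 mxE.
  rewrite !bform0l !bformDl !bformZl xx vv xv vx !yK // !mulr0 !addr0 add0r.
  move/eqP; rewrite mulf_eq0 (negPf h0) orbF => /eqP s0.
  move/eqP; rewrite mulf_eq0 (negPf h0) orbF => /eqP t0; move: w0.
  rewrite s0 t0 !scale0r !add0r -(mul0mx _ K) => /(row_free_inj fK) ->.
  by rewrite mul0mx /hrow raddf0 !row_mx0.
have uB : B \in unitmx by rewrite -row_free_unit; apply: inj_row_free.
exists B, (K *m A *m K^T); split=> //.
- by rewrite mul_hrow_col scale1r scale0r mul0mx !addr0.
- by rewrite !trmx_mul trmxK sA mulmxA.
- rewrite -row_free_unit; apply: inj_row_free => y yK.
  (* If [y] is in the kernel of [A'], then [y *m K] is orthogonal to all rows of [B], hence zero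
     since [A] and [B] are invertible. *)
  have yA : y *m (K *m A) *m B^T = 0.
    rewrite !tr_col_mx !mul_mx_row -!(mulmxA y) Kx Kv yK.
    by rewrite mulmx0 !row_mx0.
  have : y *m K = 0.
    rewrite -[y *m K](mulmxK uA) -(mulmxA y).
    have uBt : B^T \in unitmx by rewrite unitmx_tr.
    by rewrite -[y *m (K *m A)](mulmxK uBt) yA !mul0mx.
  by rewrite -(mul0mx _ K) => /(row_free_inj fK).
move=> a b y; rewrite /B !map_col_mx mul_hrow_col.
have PK w z : K *m A *m w^T = 0 -> bform (polyM A) (z *m polyM K) (polyM w) = 0.
  move=> Kw; rewrite /bform matrix.map_trmx -!mulmxA -!map_mxM mulmxA Kw.
  by rewrite map_mx0 mulmx0 mxE.
have sPA : (polyM A)^T = polyM A by rewrite matrix.map_trmx sA.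
have := PK _ y Kx; have := PK _ y Kv => yv yx.
rewrite /qform !bformDl !bformDr !bformZl !bformZr yv yx.
rewrite [bform _ (polyM x) (y *m _)]bformC // [bform _ (polyM v) (y *m _)]bformC // yv yx.
rewrite !bform_polyC xx vv xv vx -[bform _ (y *m _) _]/(qform _ _) qform_mul.
rewrite matrix.map_trmx -!map_mxM polyC0.
suff: (2%:R^-1)%:P + (2%:R^-1)%:P = 1 :> {poly F}.
  move=> E; rewrite !mulr0 !addr0 !add0r; congr (_ + _).
  by rewrite -[in RHS](mulr1 (a * b)) -E; ring.
by rewrite -polyCD; congr polyC; field.
Qed.

End Split.

(** * Polynomials and vectors of bounded degree *)

Section BoundedDegree.
Variable F : finFieldType.
Local Notation q := #|F|.

Definition size_le (d : nat) : pred {poly F} := fun p => (size p <= d)%N.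
Definition vsize_le (d n : nat) : pred 'rV[{poly F}]_n :=
  fun y => [forall i, (size (y 0%R i) <= d)%N].
Definition monic_deg (d : nat) : pred {poly F} :=
  fun u => (u \is monic) && (size u == d.+1).

Lemma card_nonzero : has_card (fun x : F => x != 0) q.-1.
Proof. by rewrite -(cardC1 (0 : F)); apply: has_card_fin. Qed.

Lemma card_size_le d : has_card (size_le d) (q ^ d).
Proof.
rewrite -card_npoly.
apply: (has_card_bij (f := val) (g := insubd (0 : {poly_d F}))) (has_card_fin _).
  by move=> p _; rewrite valKd; split=> //; apply: size_npoly.
by move=> p dp; rewrite insubdK.
Qed.

Lemma card_vsize_le d n : has_card (@vsize_le d n) (q ^ (d * n)).
Proof.
have -> : (q ^ (d * n) = #|{ffun 'I_n -> {poly_d F}}|)%N.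
  by rewrite card_ffun card_ord card_npoly expnM.
pose f (h : {ffun 'I_n -> {poly_d F}}) : 'rV[{poly F}]_n := \row_i val (h i).
pose g (y : 'rV[{poly F}]_n) := [ffun i => insubd (0 : {poly_d F}) (y 0 i)].
apply: (has_card_bij (f := f) (g := g)) (has_card_fin _) => [h _|y /forallP yd].
  split; first by apply/forallP=> i; rewrite mxE; apply: size_npoly.
  by apply/ffunP=> i; rewrite ffunE mxE valKd.
by split=> //; apply/rowP=> i; rewrite mxE ffunE insubdK //; apply: yd.
Qed.

Lemma card_monic_deg d : has_card (monic_deg d) (q ^ d).
Proof.
apply: (has_card_bij (f := fun p => 'X^d + p) (g := fun u => u - 'X^d)) (card_size_le d)
  => [p pd|u].
  split; last by rewrite addrC addKr.
  have sp : (size p < size ('X^d : {poly F}))%N by rewrite size_polyXn.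
  by rewrite /monic_deg monicE lead_coefDl // lead_coefXn size_polyDl // size_polyXn !eqxx.
case/andP=> um /eqP su; split; last by rewrite addrC subrK.
rewrite /size_le; apply/leq_sizeP => j; rewrite leq_eqVlt coefB coefXn => /orP[/eqP <-|dj].
  by move: um; rewrite monicE lead_coefE su => /eqP ->; rewrite eqxx subrr.
by rewrite nth_default ?su // gtn_eqF // subr0.
Qed.

Lemma monic_deg_neq0 d u : monic_deg d u -> u != 0.
Proof. by case/andP => /monic_neq0. Qed.

Lemma monic_deg_div d l u v : monic_deg d u -> monic_deg l v -> (l <= d)%N ->
  monic_deg (d - l) (u %/ v).
Proof.
move=> ud vl ld; have v0 := monic_deg_neq0 vl.
case/andP: ud vl => um /eqP us /andP[vm /eqP vs].
have sd : size (u %/ v) = (d - l).+1 by rewrite size_divp // us vs subSn.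
rewrite /monic_deg sd eqxx andbT monicE -(lead_coef_Mmonic _ vm).
suff <- : lead_coef u = lead_coef (u %/ v * v) by rewrite -monicE.
have s0 : u %/ v != 0 by rewrite -size_poly_gt0 sd.
rewrite {1}(divp_eq u v) lead_coefDl //; apply: leq_trans (ltn_modpN0 u v0) _.
by rewrite size_Mmonic // vs sd addnS ltnS leq_addl.
Qed.

Lemma monic_deg_mulD d l s v r : monic_deg (d - l) s -> monic_deg l v -> (l <= d)%N ->
  size_le l r -> monic_deg d (s * v + r).
Proof.
case/andP=> sm /eqP ss /andP[vm /eqP vs] ld rl.
have ssv : size (s * v) = d.+1.
  by rewrite size_Mmonic ?monic_neq0 // ss vs addnS /= addSn subnK.
have lt : ((size r) < (size (s * v)%R))%N by rewrite ssv ltnS (leq_trans rl).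
rewrite /monic_deg monicE lead_coefDl // lead_coef_Mmonic // (monicP sm).
by rewrite size_polyDl // ssv !eqxx.
Qed.

Lemma divp_mulD s v r l : monic_deg l v -> size_le l r -> (s * v + r) %/ v = s.
Proof. by case/andP=> _ /eqP vs rl; apply: divp_addl_mul_small; rewrite vs ltnS. Qed.

Lemma modp_mulD s v r l : monic_deg l v -> size_le l r -> (s * v + r) %% v = r.
Proof. by case/andP=> _ /eqP vs rl; apply: modp_addl_mul_small; rewrite vs ltnS. Qed.

Lemma size_modp_monic l u v : monic_deg l v -> size_le l (u %% v).
Proof.
move=> vl; have := ltn_modpN0 u (monic_deg_neq0 vl).
by case/andP: vl => _ /eqP ->; rewrite ltnS.
Qed.

(* [b |-> swap u v c b] exchanges, with inverse [swap v u c], the [b] of degree [< deg u] such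
   that [u] divides [v b + c] and the [w] of degree [< deg v] such that [v] divides [u w + c]. *)
Definition swap (u v c b : {poly F}) : {poly F} := (- ((v * b + c) %/ u)) %% v.

Section Swap.
Variables u v c b : {poly F}.
Hypothesis u_dvd : u %| v * b + c.

(** With [W] the quotient [(v * b + c) %/ u], one has [c = u * W - v * b], and [swap] is [- W] up to
    a multiple of [v], so [u * W] cancels. The cofactor of [v] is explicit because [swapK] reduces
    it modulo [u]. *)
Lemma swap_eq : u * swap u v c b + c = v * (- b - u * (- ((v * b + c) %/ u) %/ v)).
Proof.
have uW : u * ((v * b + c) %/ u) = v * b + c by rewrite mulrC divpK.
rewrite /swap; move: uW; set W := _ %/ u => uW.
have -> : (- W) %% v = - W - (- W) %/ v * v.
  by rewrite {2}(divp_eq (- W) v) addrAC subrr add0r.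
have -> : c = u * W - v * b by rewrite uW addrAC subrr add0r.
by ring.
Qed.

Lemma swap_dvd : v %| u * swap u v c b + c.
Proof. by rewrite swap_eq dvdp_mulIl. Qed.

Lemma swapK : v != 0 -> (size b < size u)%N -> swap v u c (swap u v c b) = b.
Proof.
move=> v0 bu; rewrite {1}/swap swap_eq mulKp // opprB opprK addrC modpD.
by rewrite modp_small // modp_mulr addr0.
Qed.

End Swap.

Section Vectors.
Variable n : nat.
Implicit Types y z : 'rV[{poly F}]_n.

Definition vdiv (v : {poly F}) y := map_mx (fun p => p %/ v) y.
Definition vmod (v : {poly F}) y := map_mx (fun p => p %% v) y.

Lemma vdiv_eq v y : y = v *: vdiv v y + vmod v y.
Proof. by apply/rowP=> i; rewrite !mxE mulrC -divp_eq. Qed.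

Lemma vsize_le_div d l v y : vsize_le d y -> monic_deg l v -> vsize_le (d - l) (vdiv v y).
Proof.
move=> /forallP yd vl; apply/forallP=> i; rewrite mxE size_divp ?(monic_deg_neq0 vl) //.
by case/andP: vl => _ /eqP ->; rewrite leq_sub2r.
Qed.

Lemma vsize_le_mod l v y : monic_deg l v -> vsize_le l (vmod v y).
Proof. by move=> vl; apply/forallP=> i; rewrite mxE; apply: size_modp_monic. Qed.

Lemma size_mul_monic_add d l v p r : monic_deg l v -> (l <= d)%N ->
  size_le (d - l) p -> size_le l r -> size_le d (v * p + r).
Proof.
case/andP=> vm /eqP vs ld pd rl; rewrite /size_le.
apply: leq_trans (size_polyD _ _) _; rewrite geq_max (leq_trans rl) // andbT.
have [->|p0] := eqVneq p 0; first by rewrite mulr0 size_poly0.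
by rewrite size_monicM // vs addSn /= -(subnKC ld) leq_add2l.
Qed.

Lemma vsize_le_mulD d l v y z : monic_deg l v -> (l <= d)%N ->
  vsize_le (d - l) y -> vsize_le l z -> vsize_le d (v *: y + z).
Proof.
move=> vl ld /forallP yd /forallP zl; apply/forallP=> i; rewrite !mxE.
exact: size_mul_monic_add (yd i) (zl i).
Qed.

Lemma vdiv_mulD l v y z : monic_deg l v -> vsize_le l z -> vdiv v (v *: y + z) = y.
Proof.
move=> vl /forallP zl; apply/rowP=> i; rewrite !mxE mulrC.
exact: divp_mulD (zl i).
Qed.

Lemma vmod_mulD l v y z : monic_deg l v -> vsize_le l z -> vmod v (v *: y + z) = z.
Proof.
move=> vl /forallP zl; apply/rowP=> i; rewrite !mxE mulrC.
exact: modp_mulD (zl i).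
Qed.

Lemma qform_congr (M : 'M[{poly F}]_n) v y z :
  v %| qform M (v *: y + z) - qform M z.
Proof.
rewrite /qform bformDl !bformDr !bformZl !bformZr addrA addrK -!mulrDr.
exact: dvdp_mulIl.
Qed.

End Vectors.

Definition Rset n (A : 'M[F]_n) (d : nat) : pred ({poly F} * 'rV[{poly F}]_n) :=
  fun x => [&& monic_deg d x.1, vsize_le d x.2 & x.1 %| qform (polyM A) x.2].

End BoundedDegree.

(** * Zeros modulo monic polynomials *)

Section EuclidStep.
Variables (F : finFieldType) (n : nat) (A : 'M[F]_n).
Local Notation q := #|F|.
Local Notation Q := (qform (polyM A)).
Local Notation tuples := ({poly F} * ({poly F} * ({poly F} * 'rV[{poly F}]_n)))%type.

(** The analogue of [Rset] for the form [a * b + Q y], in coordinates adapted to a hyperbolic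
    plane. *)
Definition Xset (d : nat) : pred tuples :=
  fun '(u, (a, (b, y))) =>
    [&& monic_deg d u, size_le d a, size_le d b, vsize_le d y & u %| a * b + Q y].

Lemma monic_deg_lead (p : {poly F}) l : size p = l.+1 ->
  lead_coef p != 0 /\ monic_deg l ((lead_coef p)^-1 *: p).
Proof.
move=> pl; have p0 : lead_coef p != 0 by rewrite lead_coef_eq0 -size_poly_gt0 pl.
split=> //; rewrite /monic_deg monicE lead_coefZ mulVf // size_scale ?invr_eq0 //.
by rewrite pl !eqxx.
Qed.

Lemma lead_scale_monic l (c : F) (v : {poly F}) : c != 0 -> monic_deg l v ->
  lead_coef (c *: v) = c /\ size (c *: v) = l.+1.
Proof.
by move=> c0 /andP[/monicP vm /eqP vs]; rewrite lead_coefZ vm mulr1 size_scale.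
Qed.

(* Write [a = c v] with [v] monic; reducing [u] and [y] modulo [v] leaves the quotients free. *)
Lemma card_Xset_deg d l k : (l < d)%N -> has_card (Xset l) k ->
  has_card (fun x => Xset d x && (size x.2.1 == l.+1))
    (q.-1 * (q ^ (d - l) * (q ^ ((d - l) * n) * k))).
Proof.
move=> ltld ck; have ld := ltnW ltld.
have := has_cardX (card_nonzero F) (has_cardX (card_monic_deg F (d - l))
  (has_cardX (card_vsize_le F (d - l) n) ck)).
(* In the reduced tuple [v] becomes the modulus and [u %% v] takes the place of [a], as in one step
   of Euclid's algorithm; [swap] carries [b] along. *)
pose f (x : tuples) :=
  let: (u, (a, (b, y))) := x in
  let c := lead_coef a in let v := c^-1 *: a in
  (c, (u %/ v, (vdiv v y, (v, (u %% v, (swap u v (Q y) (c *: b), vmod v y)))))).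
pose g (x : F * ({poly F} * ('rV[{poly F}]_n * tuples))) :=
  let: (c, (s, (z, (v, (r, (w, y)))))) := x in
  let u := s * v + r in let y' := v *: z + y in
  (u, (c *: v, (c^-1 *: swap v u (Q y') w, y'))).
apply: (has_card_bij (f := g) (g := f)) => [[c [s [z [v [r [w y]]]]]]|[u [a [b y]]]] /=.
  case/and4P=> c0 sd zd /and5P[vl rl wl yl dvd].
  have [lcv scv] := lead_scale_monic c0 vl.
  have ud := monic_deg_mulD sd vl ld rl.
  (* Modulo [v], the first factor is [r], and [Q] takes the same value at [v *: z + y] and at
     [y]. *)
  have dvd' : v %| (s * v + r) * w + Q (v *: z + y).
    have -> : (s * v + r) * w + Q (v *: z + y) =
      s * w * v + (Q (v *: z + y) - Q y) + (r * w + Q y) by ring.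
    by rewrite dvdp_add // dvdp_add ?qform_congr ?dvdp_mulIr.
  have cv : (lead_coef (c *: v))^-1 *: (c *: v) = v.
    by rewrite lcv scalerA mulVf // scale1r.
  split.
    rewrite ud scv eqxx (vsize_le_mulD vl) // !andbT /=; apply/and3P; split.
    - by rewrite /size_le scv.
    - by rewrite /size_le size_scale ?invr_eq0 //; apply: size_modp_monic ud.
    - by rewrite -scalerAl -scalerAr scalerA mulfV // scale1r; apply: swap_dvd.
  rewrite cv lcv scalerA mulfV // scale1r (divp_mulD _ vl) // (modp_mulD _ vl) //.
  rewrite (vdiv_mulD _ vl) // (vmod_mulD _ vl) // swapK //; first exact: monic_deg_neq0 ud.
  by move: wl; rewrite /size_le; case/andP: vl => _ /eqP ->; rewrite ltnS.
case/andP=> /and5P[ud ad bd yd dvd] /eqP al.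
have [c0 vl] := monic_deg_lead al.
(* Abstracting the leading coefficient and the normalised polynomial replaces [a] by [c *: v]
   everywhere. *)
move: (lead_coef a) c0 vl (erefl ((lead_coef a)^-1 *: a)) => c c0.
move: {-2}(c^-1 *: a) => v vl Ev.
have {Ev} Ea : a = c *: v by rewrite -Ev scalerA mulfV // scale1r.
have dvd' : u %| v * (c *: b) + Q y by rewrite -scalerAr scalerAl -Ea.
have Eu : u %/ v * v + u %% v = u by rewrite -divp_eq.
rewrite Eu -vdiv_eq -Ea swapK //; first last.
- by case/andP: ud => _ /eqP ->; rewrite size_scale // ltnS.
- exact: monic_deg_neq0 vl.
rewrite scalerA mulVf // scale1r; split=> //.
rewrite c0 (monic_deg_div ud) // (vsize_le_div yd) // vl (size_modp_monic _ vl).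
rewrite (size_modp_monic _ vl) (vsize_le_mod _ vl) /=.
have /(dvdp_addr _ ) <- :
  v %| (u %/ v) * v * swap u v (Q y) (c *: b) + (Q y - Q (vmod v y)).
  rewrite dvdp_add //; first by rewrite mulrAC dvdp_mulIr.
  by rewrite {1}(vdiv_eq v y) qform_congr.
set w := swap _ _ _ _.
have -> : u %/ v * v * w + (Q y - Q (vmod v y)) + (u %% v * w + Q (vmod v y)) =
  (u %/ v * v + u %% v) * w + Q y by ring.
by rewrite Eu swap_dvd.
Qed.

(** Strong induction on the degree of the modulus. If [a] is 0, then [b] is free and [(u, y)] lies
    in [Rset A d]; if [a] has degree [l], the Euclidean step leads to [Xset l]. *)
Lemma card_Xset (r : nat -> nat) (C : nat -> nat) :
    (forall d, has_card (Rset A d) (r d)) ->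
    (forall d, C d = q ^ d * r d +
       \sum_(l < d) q.-1 * (q ^ (d - l) * (q ^ ((d - l) * n) * C l)))%N ->
  forall d, has_card (Xset d) (C d).
Proof.
move=> cr HC; elim/ltn_ind=> d IHd; rewrite HC.
apply: (has_card_split (C := fun x : tuples => x.2.1 == 0)).
  apply: (has_card_bij (f := fun x : {poly F} * ({poly F} * 'rV[{poly F}]_n) =>
      (x.2.1, (0, (x.1, x.2.2)))) (g := fun x => (x.2.2.1, (x.1, x.2.2.2))))
      (has_cardX (card_size_le F d) (cr d)).
    move=> [b [u y]] /= /and4P[/= bd ud yd dvd].
    by rewrite eqxx ud yd bd /size_le size_poly0 mul0r add0r dvd.
  move=> [u [a [b y]]] /= /andP[/and5P[ud ad bd yd]] + /eqP a0.
  by rewrite a0 mul0r add0r => dvd; rewrite bd /Rset /= ud yd dvd.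
apply: (has_card_sum (pi := fun x : tuples => (size x.2.1).-1)
    (w := fun l => (q.-1 * (q ^ (d - l) * (q ^ ((d - l) * n) * C l)))%N))
  => [[u [a [b y]]]|l ld].
  case/andP=> /and5P[_ ad _ _ _] /=; rewrite -size_poly_gt0; move: ad; rewrite /size_le.
  by case: (size a).
apply: has_card_eq (card_Xset_deg ld (IHd l ld)) => -[u [a [b y]]] /=.
rewrite -size_poly_gt0 -!andbA; do 5!congr (_ && _).
by case: (size a) => //= s; rewrite eqSS.
Qed.

End EuclidStep.

(** * Dimension 1: monic divisors of squares *)

Section SquareStep.
Variable F : finFieldType.
Local Notation q := #|F|.

Definition Sset (d : nat) : pred ({poly F} * {poly F}) :=
  fun '(u, z) => [&& monic_deg d u, size_le d z & u %| z ^+ 2].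

Lemma monic_deg_sqr e (z : {poly F}) : monic_deg e z -> monic_deg (e.*2) (z ^+ 2).
Proof.
case/andP=> zm /eqP zs; rewrite /monic_deg expr2 monicMl // zm /=.
by rewrite size_Mmonic ?monic_neq0 // zs addSn addnS /= addnn.
Qed.

(** Write [z = c y] with [y] monic of degree [e]. The complementary divisor [v = y ^+ 2 %/ u] has
    degree [2e - d], and [v] divides the square of [y %% v]. The leading coefficient [c] and the
    monic quotient [y %/ v], of degree [d - e], are free; [u] is recovered as [y ^+ 2 %/ v]. *)
Lemma card_Sset_deg d e k : (e < d <= e.*2)%N -> has_card (Sset (e.*2 - d)) k ->
  has_card (fun x => Sset d x && (size x.2 == e.+1)) (q.-1 * (q ^ (d - e) * k)).
Proof.
case/andP=> ed de ck; set l := (e.*2 - d)%N in ck *.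
have le : (l <= e)%N by rewrite /l; lia.
have ll : (l <= e.*2)%N by rewrite /l; lia.
have Ede : (e - l = d - e)%N by rewrite /l; lia.
have Ed : (e.*2 - l = d)%N by rewrite /l; lia.
have := has_cardX (card_nonzero F) (has_cardX (card_monic_deg F (d - e)) ck).
pose f (x : {poly F} * {poly F}) :=
  let: (u, z) := x in
  let c := lead_coef z in let y := c^-1 *: z in let v := y ^+ 2 %/ u in
  (c, (y %/ v, (v, y %% v))).
pose g (x : F * ({poly F} * ({poly F} * {poly F}))) :=
  let: (c, (s, (v, r))) := x in let y := s * v + r in (y ^+ 2 %/ v, c *: y).
apply: (has_card_bij (f := g) (g := f)) => [[c [s [v r]]]|[u z]] /=.
  case/and3P=> c0 sd /and3P[vl rl dvd]; rewrite -Ede in sd.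
  have ye := monic_deg_mulD sd vl le rl.
  have dvdy : v %| (s * v + r) ^+ 2.
    have -> : (s * v + r) ^+ 2 = (s * s * v + (s * r) *+ 2) * v + r ^+ 2 by ring.
    by rewrite dvdp_add // dvdp_mulIr.
  have ud := monic_deg_div (monic_deg_sqr ye) vl ll; rewrite Ed in ud.
  have uv : (s * v + r) ^+ 2 %/ v * v = (s * v + r) ^+ 2 by rewrite divpK.
  have [lcy scy] := lead_scale_monic c0 ye.
  have cy : (lead_coef (c *: (s * v + r)))^-1 *: (c *: (s * v + r)) = s * v + r.
    by rewrite lcy scalerA mulVf // scale1r.
  split.
    rewrite ud scy eqxx andbT /=; apply/andP; split; first by rewrite /size_le scy.
    by rewrite exprZn dvdpZr ?expf_neq0 // -[X in _ %| X]uv dvdp_mulIl.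
  rewrite cy lcy.
  have -> : (s * v + r) ^+ 2 %/ ((s * v + r) ^+ 2 %/ v) = v.
    by rewrite -{1}uv mulKp // (monic_deg_neq0 ud).
  by rewrite (divp_mulD _ vl) // (modp_mulD _ vl).
case/andP=> /and3P[ud zd dvd] /eqP ze.
have [c0 ye] := monic_deg_lead ze.
move: (lead_coef z) c0 ye (erefl ((lead_coef z)^-1 *: z)) => c c0.
move: {-2}(c^-1 *: z) => y ye Ey.
have {Ey} Ez : z = c *: y by rewrite -Ey scalerA mulfV // scale1r.
have dvdy : u %| y ^+ 2 by move: dvd; rewrite Ez exprZn dvdpZr ?expf_neq0.
have vl := monic_deg_div (monic_deg_sqr ye) ud de; rewrite -/l in vl.
have uv : y ^+ 2 = u * (y ^+ 2 %/ u) by rewrite mulrC divpK.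
rewrite -divp_eq -Ez; split; last first.
  by congr pair; rewrite {1}uv mulpK // (monic_deg_neq0 vl).
have sd := monic_deg_div ye vl le; rewrite Ede in sd.
rewrite c0 sd vl (size_modp_monic _ vl) /=.
set v := y ^+ 2 %/ u in uv *.
have -> : (y %% v) ^+ 2 = (u + v * (y %/ v) ^+ 2 - (y %/ v * y) *+ 2) * v.
  rewrite mulrBl mulrDl -uv {1}(_ : y %% v = y - y %/ v * v); first by ring.
  by rewrite {2}(divp_eq y v) addrAC subrr add0r.
by rewrite dvdp_mulIr.
Qed.

Lemma card_Sset (C : nat -> nat) :
    (forall d, C d = q ^ d +
       \sum_(e < d) if (d <= e.*2)%N then q.-1 * (q ^ (d - e) * C (e.*2 - d)) else 0)%N ->
  forall d, has_card (Sset d) (C d).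
Proof.
move=> HC; elim/ltn_ind=> d IHd; rewrite HC.
apply: (has_card_split (C := fun x : {poly F} * {poly F} => x.2 == 0)).
  apply: (has_card_bij (f := fun u : {poly F} => (u, 0)) (g := fst))
      (card_monic_deg F d).
    by move=> u ud /=; rewrite ud /size_le size_poly0 expr0n /= dvdp0 eqxx.
  by move=> [u z] /= /andP[/and3P[ud _ _] /eqP ->].
apply: (has_card_sum (pi := fun x : {poly F} * {poly F} => (size x.2).-1)
   (w := fun e => if (d <= e.*2)%N then (q.-1 * (q ^ (d - e) * C (e.*2 - d)))%N else 0%N))
   => [[u z]|e ed].
  case/andP=> /and3P[_ zd _] /=; rewrite -size_poly_gt0; move: zd; rewrite /size_le.
  by case: (size z).
have E x : Sset d x && (size x.2 == e.+1) =
    (Sset d x && (x.2 != 0)) && ((size x.2).-1 == e).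
  rewrite -size_poly_gt0 -andbA; congr (_ && _).
  by case: (size x.2) => //= s; rewrite eqSS.
apply: has_card_eq E _; case: ifP => de.
  have lt : (e.*2 - d < d)%N by clear -ed de; lia.
  by apply: card_Sset_deg (IHd _ lt); apply/andP.
(* When [2e < d], the nonzero square of [z] has degree too small to be divisible by [u]. *)
exists [::]; split=> // -[u z]; rewrite in_nil; apply/esym/negP.
case/andP=> /and3P[ud zd dvd] /= /eqP ze; move: de.
have [c0 ye] := monic_deg_lead ze.
have z0 : z != 0 by rewrite -size_poly_gt0 ze.
have := dvdp_leq _ dvd; rewrite expf_neq0 // => /(_ isT).
case/andP: ud => _ /eqP ->; rewrite expr2 size_mul // ze addSn addnS /= addnn ltnS.
by move=> ->.
Qed.

Lemma card_Rset1 (A : 'M[F]_1) d k : A \in unitmx -> has_card (Sset d) k ->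
  has_card (Rset A d) k.
Proof.
move=> uA; have a0 : A 0 0 != 0.
  by move: uA; rewrite unitmxE {1}(mx11_scalar A) det_scalar1 unitfE.
have dvdE (u : {poly F}) y : (u %| qform (polyM A) y) = (u %| y 0 0 ^+ 2).
  rewrite qform_sum !big_ord1 mxE mulrAC mulrC.
  by rewrite mul_polyC dvdpZr // expr2.
apply: (has_card_bij (f := fun x : {poly F} * {poly F} => (x.1, x.2%:M : 'rV_1))
   (g := fun x : {poly F} * 'rV[{poly F}]_1 => (x.1, x.2 0 0))).
  move=> [u z] /and3P[ud zd dvd]; rewrite /Rset /= dvdE ud !mxE eqxx mulr1n.
  by split=> //; rewrite dvd andbT; apply/forallP=> i; rewrite !ord1 mxE eqxx.
move=> [u y] /and3P[/= ud /forallP yd]; rewrite dvdE -mx11_scalar => dvd.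
by rewrite ud dvd andbT; split=> //; apply: yd.
Qed.

End SquareStep.

(** * Change of coordinates by a constant matrix *)

Section Split.
Variables (F : finFieldType) (n : nat).

Lemma vsize_le_row_mx d m1 m2 (x : 'rV[{poly F}]_m1) (y : 'rV[{poly F}]_m2) :
  vsize_le d (row_mx x y) = vsize_le d x && vsize_le d y.
Proof.
apply/forallP/andP => [xy|[/forallP xd /forallP yd] i].
  split; apply/forallP => i; first by have := xy (lshift _ i); rewrite row_mxEl.
  by have := xy (rshift _ i); rewrite row_mxEr.
by rewrite mxE; case: splitP => j _.
Qed.

Lemma vsize_le_hrow d (a b : {poly F}) (y : 'rV[{poly F}]_n) :
  vsize_le d (hrow a b y) = [&& size_le d a, size_le d b & vsize_le d y].
Proof.
rewrite !vsize_le_row_mx; congr [&& _, _ & _].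
all: apply/forallP/idP => [/(_ 0)|ad i]; by rewrite ?ord1 mxE eqxx mulr1n.
Qed.

Lemma vsize_le_mulmx d m1 m2 (x : 'rV[{poly F}]_m1) (B : 'M[F]_(m1, m2)) :
  vsize_le d x -> vsize_le d (x *m polyM B).
Proof.
move=> /forallP xd; apply/forallP=> j; rewrite mxE.
apply: leq_trans (size_sum _ _ _) _; apply/bigmax_leqP => i _.
by rewrite mxE mulrC mul_polyC (leq_trans (size_scale_leq _ _)).
Qed.

(** [B] and its inverse have constant entries, so both directions of the change of variables respect
    the degree bounds. *)
Lemma card_Rset_Xset (A : 'M[F]_(1 + (1 + n))) B (A' : 'M[F]_n) d k :
    B \in unitmx ->
    (forall (a b : {poly F}) y,
       qform (polyM A) (hrow a b y *m polyM B) = a * b + qform (polyM A') y) ->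
  has_card (Xset A' d) k -> has_card (Rset A d) k.
Proof.
move=> uB QB.
pose f (x : {poly F} * ({poly F} * ({poly F} * 'rV[{poly F}]_n))) :=
  let: (u, (a, (b, y))) := x in (u, hrow a b y *m polyM B).
pose g (x : {poly F} * 'rV[{poly F}]_(1 + (1 + n))) :=
  let z := x.2 *m polyM (invmx B) in
  (x.1, (lsubmx z 0 0, (lsubmx (rsubmx z) 0 0, rsubmx (rsubmx z)))).
have BK (z : 'rV[{poly F}]_(1 + (1 + n))) : z *m polyM B *m polyM (invmx B) = z.
  by rewrite -mulmxA -map_mxM mulmxV // map_mx1 mulmx1.
have KB (z : 'rV[{poly F}]_(1 + (1 + n))) : z *m polyM (invmx B) *m polyM B = z.
  by rewrite -mulmxA -map_mxM mulVmx // map_mx1 mulmx1.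
apply: (has_card_bij (f := f) (g := g)) => [[u [a [b y]]]|[u x]].
  case/and5P=> ud ad bd yd dvd; rewrite /g /= BK; split.
    by rewrite /Rset /= ud QB dvd vsize_le_mulmx // vsize_le_hrow ad bd.
  by have [<- <- <-] := hrow_inj (hrow_surj (hrow a b y)).
case/and3P=> /= ud xd dvd; rewrite -hrow_surj KB; split=> //.
have := vsize_le_mulmx (invmx B) xd; rewrite [X in vsize_le _ X]hrow_surj vsize_le_hrow.
by rewrite ud => /and3P[-> -> ->]; rewrite -QB -hrow_surj KB.
Qed.

End Split.

(** * Telescoping the recursions for the divisor counts *)

Section ResidueCount.
Local Open Scope nat_scope.

(** The value of R(d) in dimension [2m + 1], by the one-step recursion equivalent to the summations
    that the counting produces. *)
Fixpoint rcount (q m d : nat) : nat :=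
  if d is d'.+1 then
    q ^ m.*2.+1 * rcount q m d' + (if odd d' then q ^ (m * d) * (q.-1 * q ^ d') else 0)
  else 1.

(** Going from [d] to [d.+2]: the new term [e = 0] vanishes, the last one is [(q - 1) q R(d)], and
    those between are [q] times the terms for [d]. *)
Lemma rcount0_rec q d : 0 < q ->
  rcount q 0 d = q ^ d +
    \sum_(e < d) if d <= e.*2 then q.-1 * (q ^ (d - e) * rcount q 0 (e.*2 - d)) else 0.
Proof.
(* Writing [q] as [p.+1] turns [q.-1] into [p], so that [ring] meets no truncated subtraction. *)
case: q => // p _; elim/ltn_ind: d => -[|[|d]] IHd.
- by rewrite big_ord0.
- by rewrite big_ord1 /= muln1 addn0.
rewrite big_ord_recl /= add0n big_ord_recr /=.
have -> : d.+2 <= (bump 0 d).*2 by rewrite /bump /=; lia.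
have -> : d.+2 - bump 0 d = 1 by rewrite /bump /=; lia.
have -> : (bump 0 d).*2 - d.+2 = d by rewrite /bump /=; lia.
under eq_bigr => e _.
  have -> : (d.+2 <= (bump 0 e).*2) = (d <= e.*2) by rewrite /bump /=; lia.
  have -> : d.+2 - bump 0 e = (d - e).+1 by rewrite /bump /=; have := ltn_ord e; lia.
  have -> : (bump 0 e).*2 - d.+2 = e.*2 - d by rewrite /bump /=; lia.
  have -> : (if d <= e.*2 then p * (p.+1 ^ (d - e).+1 * rcount p.+1 0 (e.*2 - d)) else 0)
     = p.+1 * (if d <= e.*2 then p * (p.+1 ^ (d - e) * rcount p.+1 0 (e.*2 - d)) else 0).
    by case: ifP => _; rewrite ?muln0 // expnS; ring.
  over.
rewrite -big_distrr /=; have := IHd d (ltnW (leqnn _)).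
set S := \sum_(_ < d) _; set R := rcount _ _ d => E.
rewrite !mul0n !expn0 !mul1n !expn1 [p.+1 ^ d.+2]expnS [p.+1 ^ d.+1]expnS.
(* Exactly one of [d] and [d.+1] is odd, so two steps of [rcount] contribute exactly one correction
   term. *)
by case: (odd d) => /=; rewrite E; ring.
Qed.

(** Going from [d] to [d.+1] multiplies the old terms by [q ^ (2m + 2)] and adds the term [l = d];
    the recursion of [rcount q m] then leaves only the correction for odd [d]. *)
Lemma rcount_rec q m d : 0 < q ->
  rcount q m.+1 d = q ^ d * rcount q m d +
    \sum_(l < d) q.-1 * (q ^ (d - l) * (q ^ ((d - l) * m.*2.+1) * rcount q m.+1 l)).
Proof.
case: q => // p _; elim: d => [|d IHd]; first by rewrite big_ord0.
rewrite big_ord_recr /= subSnn mul1n.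
under eq_bigr => l _.
  have -> : p * (p.+1 ^ (d.+1 - l) * (p.+1 ^ ((d.+1 - l) * m.*2.+1) * rcount p.+1 m.+1 l)) =
    p.+1 ^ m.*2.+2 *
      (p * (p.+1 ^ (d - l) * (p.+1 ^ ((d - l) * m.*2.+1) * rcount p.+1 m.+1 l))).
    by rewrite subSn ?(ltnW (ltn_ord l)) // mulSn expnD !expnS; ring.
  over.
rewrite -big_distrr /=; move: IHd => /=.
set S := \sum_(_ < d) _; set R := rcount _ m.+1 d; set r := rcount _ m d => E.
rewrite doubleS mulSn [p.+1 ^ (_ + m * _)]expnD !expnS !expn0.
by case: (odd d); rewrite E; ring.
Qed.

End ResidueCount.

Section Residues.
Variable F : finFieldType.
Hypothesis F_odd : odd #|F|.
Local Notation q := #|F|.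

(** Induction on [m]: above dimension 1 an isotropic vector exists, and splitting off its hyperbolic
    plane lowers the dimension by 2. The result depends on [A] only through its size. *)
Lemma card_Rset m (A : 'M[F]_(m.*2.+1)) : A^T = A -> A \in unitmx ->
  forall d, has_card (Rset A d) (rcount q m d).
Proof.
have q0 : (0 < q)%N by rewrite ltnW // finNzRing_gt1.
elim: m A => [|m IHm] A sA uA d.
  by apply: card_Rset1 => //; apply: card_Sset => {}d; apply: rcount0_rec.
have [//|x x0 qx] := isotropic_exists F_odd sA.
have [B [A' [uB _ sA' uA' QB]]] :=
  @hyperbolic_split _ m.*2.+1 A (two_neq0 F_odd) sA uA x x0 qx.
apply: (@card_Rset_Xset _ m.*2.+1 A B A') => //.
apply: card_Xset d; first by move=> d; apply: IHm.
by move=> d; apply: rcount_rec.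
Qed.

End Residues.

(** * Zeros of bounded degree *)

Section Zeros.
Variable F : finFieldType.
Hypothesis F_odd : odd #|F|.
Local Notation q := #|F|.

Definition Nset n (A : 'M[F]_n) (P : nat) : pred 'rV[{poly F}]_n :=
  fun x => vsize_le P x && (qform (polyM A) x == 0).

Let q_gt0 : (0 < q)%N. Proof. by rewrite ltnW // finNzRing_gt1. Qed.

(* A polynomial divisor of degree 1 and constant coordinates: [R(1) = q * #isotropic]. *)
Lemma card_isotropic m (A : 'M[F]_(m.*2.+1)) : A^T = A -> A \in unitmx ->
  has_card (fun x => qform A x == 0) (q ^ m.*2).
Proof.
move=> sA uA; have := has_card_fin (fun x => qform A x == 0).
set k := #|_| => ck; suff Ek : (q * k = q ^ m.*2.+1)%N.
  by move/eqP: Ek; rewrite expnS eqn_pmul2l // => /eqP <-.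
have cR := card_Rset F_odd sA uA 1; rewrite /= muln1 addn0 in cR.
apply: has_card_unique cR.
have := has_cardX (card_monic_deg F 1) ck; rewrite expn1.
apply: (has_card_bij (f := fun x : {poly F} * 'rV[F]_(m.*2.+1) => (x.1, polyM x.2))
  (g := fun x : {poly F} * 'rV[{poly F}]_(m.*2.+1) => (x.1, map_mx (coefp 0) x.2))).
  move=> [u x] /= /andP[u1 /eqP qx]; split.
    rewrite /Rset /= u1 /qform bform_polyC -/(qform A x) qx dvdp0 andbT.
    by apply/forallP=> i; rewrite mxE size_polyC leq_b1.
  by congr pair; apply/rowP=> i; rewrite !mxE /= coefC eqxx.
move=> [u x] /and3P[/= u1 /forallP x1 dvd].
have Ex : polyM (map_mx (coefp 0) x) = x.
  by apply/rowP=> i; rewrite !mxE /= -size1_polyC.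
rewrite Ex u1; split=> //=; move: dvd; rewrite -{1}Ex /qform bform_polyC => dvd.
(* A polynomial of degree 1 cannot divide a nonzero constant. *)
apply/negPn/negP => c0; have := dvdp_leq _ dvd; rewrite polyC_eq0 => /(_ c0).
by case/andP: u1 => _ /eqP ->; rewrite size_polyC; case: eqP.
Qed.

Lemma card_isotropic_neq0 m (A : 'M[F]_(m.*2.+1)) : A^T = A -> A \in unitmx ->
  has_card (fun x => (qform A x == 0) && (x != 0)) (q ^ m.*2).-1.
Proof.
move=> sA uA; have := has_card_fin (fun x => (qform A x == 0) && (x != 0)).
set k := #|_| => ck; suff -> : (q ^ m.*2)%N = k.+1 by [].
apply: has_card_unique (card_isotropic sA uA) _; rewrite -[k.+1]add1n.
apply: (has_card_split (C := fun x : 'rV[F]_(m.*2.+1) => x == 0)) => //.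
exists [:: 0]; split=> // x; rewrite inE; case: (x =P 0) => [->|x0].
  by apply/esym; rewrite -topredE /= eqxx /qform bform0l eqxx.
by apply/esym/negP => /andP[_ /eqP].
Qed.

Definition coef_row n (P : nat) (x : 'rV[{poly F}]_n) : 'rV[F]_n := map_mx (coefp P) x.

Lemma coef_row_mul n k P (x : 'rV[{poly F}]_n) (B : 'M[F]_(n, k)) :
  coef_row P (x *m polyM B) = coef_row P x *m B.
Proof.
apply/rowP=> j; rewrite !mxE /= coef_sum; apply: eq_bigr => i _.
by rewrite !mxE /= coefMC.
Qed.

Lemma coef_row_hrow n P a b (y : 'rV[{poly F}]_n) :
  coef_row P (hrow a b y) = hrow a`_P b`_P (coef_row P y).
Proof.
rewrite /coef_row /hrow !map_row_mx; congr row_mx; last congr row_mx.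
all: by apply/rowP => i; rewrite !mxE ord1 eqxx.
Qed.

Lemma vsize_leS n P (x : 'rV[{poly F}]_n) :
  vsize_le P x = vsize_le P.+1 x && (coef_row P x == 0).
Proof.
apply/forallP/andP => [xP|[/forallP xP /eqP/rowP x0] i].
  split; first by apply/forallP => i; apply: leqW.
  by apply/eqP/rowP => i; rewrite !mxE /= nth_default.
apply/leq_sizeP => j; rewrite leq_eqVlt => /orP[/eqP <-|Pj].
  by have := x0 i; rewrite !mxE.
by rewrite nth_default // (leq_trans (xP i)).
Qed.

Lemma coefM_top (p r : {poly F}) P : size_le P.+1 p -> size_le P.+1 r ->
  (p * r)`_(P + P) = p`_P * r`_P.
Proof.
move=> pP rP; have lt : (P < (P + P).+1)%N by rewrite ltnS leq_addl.
rewrite coefM (bigD1 (Ordinal lt)) //= addnK big1 ?addr0 // => i iP.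
have [Pi|iP'] := ltnP P i; first by rewrite nth_default ?mul0r // (leq_trans pP).
have {}iP : (i < P)%N by rewrite ltn_neqAle iP' andbT.
rewrite mulrC nth_default ?mul0r // (leq_trans rP) // -addnBA ?(ltnW iP) //.
by rewrite -addn1 leq_add2l subn_gt0.
Qed.

(** Comparing top coefficients shows that the row of coefficients of [t^P] of a zero is
    isotropic. *)
Lemma coef_qform n (A : 'M[F]_n) P x : vsize_le P.+1 x ->
  (qform (polyM A) x)`_(P + P) = qform A (coef_row P x).
Proof.
move=> /forallP xP; rewrite !qform_sum coef_sum; apply: eq_bigr => j _.
rewrite coef_sum; apply: eq_bigr => i _; rewrite !mxE /=.
rewrite mulrAC coefMC coefM_top; [by rewrite mulrAC | exact: xP | exact: xP].
Qed.

Lemma size_qform n (A : 'M[F]_n) P x : vsize_le P x ->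
  (size (qform (polyM A) x) <= (P + P).-1)%N.
Proof.
move=> /forallP xP; rewrite qform_sum.
apply: leq_trans (size_sum _ _ _) _; apply/bigmax_leqP => j _.
apply: leq_trans (size_sum _ _ _) _; apply/bigmax_leqP => i _.
rewrite mxE mulrAC mulrC mul_polyC; apply: leq_trans (size_scale_leq _ _) _.
apply: leq_trans (size_polyMleq _ _) _; rewrite -!subn1 leq_sub2r //.
by rewrite leq_add.
Qed.

(** As [x0] is the first row of [B], prescribing the coefficients of [t^P] means, in the new
    coordinates, that [a] is monic of degree [P] while [b] and [y] have degree [< P]. The equation
    then reads [a * b = - Q' y] and determines [b]. *)
Lemma card_Nset_fiber m (A : 'M[F]_(m.+1.*2.+1)) P (x0 : 'rV_(m.+1.*2.+1)) :
    A^T = A -> A \in unitmx -> qform A x0 = 0 -> x0 != 0 ->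
  has_card (fun x => Nset A P.+1 x && (coef_row P x == x0)) (rcount q m P).
Proof.
move=> sA uA qx0 nz.
have [B [A' [uB e1B sA' uA' QB]]] :=
  @hyperbolic_split _ m.*2.+1 A (two_neq0 F_odd) sA uA x0 nz qx0.
have := card_Rset F_odd sA' uA' P.
pose f (x : {poly F} * 'rV[{poly F}]_(m.*2.+1)) : 'rV[{poly F}]_(1 + (1 + m.*2.+1)) :=
  hrow x.1 (- (qform (polyM A') x.2 %/ x.1)) x.2 *m polyM B.
pose g (x : 'rV[{poly F}]_(1 + (1 + m.*2.+1))) :=
  let z := x *m polyM (invmx B) in (lsubmx z 0 0, rsubmx (rsubmx z)).
have BK (z : 'rV[{poly F}]_(1 + (1 + m.*2.+1))) : z *m polyM B *m polyM (invmx B) = z.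
  by rewrite -mulmxA -map_mxM mulmxV // map_mx1 mulmx1.
have KB (z : 'rV[{poly F}]_(1 + (1 + m.*2.+1))) : z *m polyM (invmx B) *m polyM B = z.
  by rewrite -mulmxA -map_mxM mulVmx // map_mx1 mulmx1.
apply: (has_card_bij (f := f) (g := g)) => [[u y]|x].
  case/and3P=> /= uP yP dvd; rewrite /g /f /= BK; split; last first.
    by have [<- _ <-] := hrow_inj (hrow_surj (hrow u (- (qform (polyM A') y %/ u)) y)).
  (* The value of the form at [y] has degree at most [2P - 2], so dividing by [u] of degree [P]
     leaves degree [< P]. *)
  have bP : size_le P (qform (polyM A') y %/ u).
    rewrite /size_le size_divp ?(monic_deg_neq0 uP) //; case/andP: uP => _ /eqP -> /=.
    by rewrite leq_subLR (leq_trans (size_qform _ yP)) // leq_pred.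
  have [yS y0] : vsize_le P.+1 y /\ coef_row P y = 0.
    by move: yP; rewrite vsize_leS => /andP[-> /eqP].
  rewrite /Nset QB mulrN mulrC divpK // addNr eqxx andbT vsize_le_mulmx; last first.
    rewrite vsize_le_hrow yS andbT /size_le size_polyN (leqW bP) andbT.
    by case/andP: uP => _ /eqP ->.
  rewrite coef_row_mul coef_row_hrow y0 -e1B coefN (nth_default _ bP) oppr0 /=.
  by case/andP: uP => /monicP; rewrite lead_coefE => + /eqP us; rewrite us => ->.
case/andP=> /andP[xP /eqP qx] /eqP cx.
have [a [b [y [Ex ->]]]] : exists a b y, x = hrow a b y *m polyM B /\ g x = (a, y).
  pose z := x *m polyM (invmx B).
  exists (lsubmx z 0 0), (lsubmx (rsubmx z) 0 0), (rsubmx (rsubmx z)).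
  by rewrite -hrow_surj KB.
have := vsize_le_mulmx (invmx B) xP; rewrite Ex BK vsize_le_hrow => /and3P[aP bP yP].
move: cx; rewrite Ex coef_row_mul -e1B => /(congr1 (mulmx^~ (invmx B))).
rewrite !mulmxK // coef_row_hrow => /hrow_inj[a1 b0 y0].
have {}yP : vsize_le P y by rewrite vsize_leS yP y0 eqxx.
have uP : monic_deg P a.
  have sa : size a = P.+1.
    apply/eqP; rewrite eqn_leq (aP : (size a <= P.+1)%N) ltnNge; apply/negP => sa.
    by move/eqP: a1; rewrite nth_default // eq_sym oner_eq0.
  by rewrite /monic_deg monicE lead_coefE sa a1 !eqxx.
move: qx; rewrite Ex QB => /eqP; rewrite addr_eq0 => /eqP ab.
rewrite /Rset /f /= uP yP -[qform _ _]opprK -ab dvdpNr dvdp_mulIl; split=> //.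
by congr (hrow _ _ _ *m _); rewrite -mulrN mulKp ?opprK // (monic_deg_neq0 uP).
Qed.

End Zeros.

(** Here [m] indexes the form left after splitting: [zcount q m] counts zeros in [2m + 3] variables,
    and the factor before [rcount] is the number of nonzero isotropic vectors. *)
Fixpoint zcount (q m P : nat) : nat :=
  (if P is P'.+1 then zcount q m P' + (q ^ m.+1.*2).-1 * rcount q m P' else 1)%N.

Section Count.
Variable F : finFieldType.
Hypothesis F_odd : odd #|F|.
Local Notation q := #|F|.

(** Zeros are sorted by their coefficients of [t^P]: the zero row leaves the zeros of smaller
    degree, and the fibres over nonzero isotropic rows all have size [rcount q m P]. *)
Lemma card_Nset m (A : 'M[F]_(m.+1.*2.+1)) P : A^T = A -> A \in unitmx ->
  has_card (Nset A P) (zcount q m P).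
Proof.
move=> sA uA; elim: P => [|P IHP] /=.
  exists [:: 0]; split=> // x; rewrite inE -topredE /=.
  apply/eqP/andP => [->|[/forallP x0 _]].
    by rewrite /qform bform0l eqxx; split=> //; apply/forallP=> i; rewrite mxE size_poly0.
  by apply/rowP=> i; have := x0 i; rewrite leqn0 size_poly_eq0 mxE => /eqP.
apply: (has_card_split (C := fun x => coef_row P x == 0)).
  apply: has_card_eq IHP => x; rewrite /Nset vsize_leS -!andbA; congr andb; exact: andbC.
apply: (has_card_fibration (pi := coef_row P) (card_isotropic_neq0 F_odd sA uA)).
  move=> x /andP[/andP[xP /eqP qx] x0].
  by rewrite x0 -(coef_qform _ xP) qx coef0 eqxx.
move=> x0 /andP[/eqP qx nz].
have := card_Nset_fiber F_odd P sA uA qx nz; apply: has_card_eq => x.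
by case: (coef_row P x =P x0) => [->|_]; rewrite ?andbF // nz !andbT.
Qed.

Lemma NP_zcount m (a : 'I_(m.+1.*2.+1) -> F) P : (forall i, a i != 0) ->
  NP a P = zcount q m P.
Proof.
move=> a0; pose A := diag_mx (\row_i a i).
have sA : A^T = A by rewrite tr_diag_mx.
have uA : A \in unitmx.
  rewrite unitmxE det_diag unitfE prodf_seq_neq0; apply/allP => i _ /=.
  by rewrite mxE.
apply: has_card_unique (card_Nset P sA uA); rewrite /NP cardsE.
have QA x : qform (polyM A) x = \sum_i (a i)%:P * x 0 i ^+ 2.
  rewrite qform_sum; apply: eq_bigr => j _; rewrite (bigD1 j) //= big1 => [|i ij].
    by rewrite !mxE eqxx mulr1n addr0; ring.
  by rewrite !mxE (negPf ij) mulr0n polyC0 mulr0 mul0r.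
apply: (has_card_bij (f := fun x : {ffun 'I_(m.+1.*2.+1) -> {poly_P F}} => \row_i val (x i))
  (g := fun y : 'rV[{poly F}]_(m.+1.*2.+1) => [ffun i => insubd (0 : {poly_P F}) (y 0 i)]))
  (has_card_fin _) => [x Sx|y /andP[/forallP yP /eqP qy]].
  have /eqP fx : diag_form a (fun i => val (x i)) == 0 by exact: Sx.
  split; last by apply/ffunP=> i; rewrite ffunE mxE valKd.
  rewrite /Nset QA; apply/andP; split; last first.
    by apply/eqP; apply: etrans fx; apply: eq_bigr => i _; rewrite mxE.
  by apply/forallP=> i; rewrite mxE size_npoly.
have Ey : \row_i val ([ffun i => insubd (0 : {poly_P F}) (y 0 i)] i) = y.
  by apply/rowP=> i; rewrite mxE ffunE insubdK //; apply: yP.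
split=> //; pose x := [ffun i => insubd (0 : {poly_P F}) (y 0 i)].
suff : diag_form a (fun i => val (x i)) == 0 by [].
apply/eqP; rewrite -[RHS]qy QA; apply: eq_bigr => i _.
by rewrite -[in RHS]Ey mxE.
Qed.

End Count.

(** * Closed forms *)

Section ClosedForms.
Variables (q m : nat).
Hypothesis q_gt1 : (1 < q)%N.
Local Notation x := (q%:R : rat).

(** Over the rationals the predecessors become genuine differences, as [q] is positive. *)
Lemma rcountS d : (rcount q m d.+1)%:R = x ^+ m.*2.+1 * (rcount q m d)%:R
  + (if odd d then x ^+ (m * d.+1) * ((x - 1) * x ^+ d) else 0) :> rat.
Proof.
rewrite /= natrD natrM natrX; congr (_ + _); case: odd => //.
by rewrite !natrM !natrX -subn1 natrB // ltnW.
Qed.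

Lemma zcountS d : (zcount q m d.+1)%:R = (zcount q m d)%:R +
  (x ^+ m.+1.*2 - 1) * (rcount q m d)%:R :> rat.
Proof. by rewrite /= natrD natrM -subn1 natrB ?natrX // expn_gt0 ltnW. Qed.

End ClosedForms.

Section StepTwo.
Variables (q m : nat).
Hypothesis q_gt1 : (1 < q)%N.
Local Notation x := (q%:R : rat).
Local Notation R d := ((rcount q m d)%:R : rat).
Local Notation N d := ((zcount q m d)%:R : rat).

Let exp_odd : x ^+ m.*2.+1 = x * (x ^+ m) ^+ 2.
Proof. by rewrite exprS -muln2 exprM. Qed.

Let exp_even : x ^+ m.+1.*2 = x ^+ 2 * (x ^+ m) ^+ 2.
Proof. by rewrite doubleS -addn2 exprD mulrC -muln2 exprM. Qed.

(** Two steps at a time remove the parity condition: of [j.*2] and [j.*2.+1] only the latter is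
    odd. *)
Lemma rcount_step_even j : R j.*2.+2 =
  (x * (x ^+ m) ^+ 2) ^+ 2 * R j.*2 + (x - 1) * x * (x ^+ m) ^+ 2 * (x ^+ m * x) ^+ j.*2.
Proof.
rewrite !(rcountS m q_gt1) [odd _.+1]/= odd_double [~~ false]/= exp_odd.
rewrite !mulnSr !exprD exprM (exprS x j.*2) (exprMn j.*2 (x ^+ m) x).
by ring.
Qed.

Lemma zcount_step_odd j : N j.*2.+1 = N j.*2 + (x ^+ 2 * (x ^+ m) ^+ 2 - 1) * R j.*2.
Proof. by rewrite (zcountS m q_gt1) exp_even. Qed.

Lemma zcount_step_even j : N j.*2.+2 =
  N j.*2 + (x ^+ 2 * (x ^+ m) ^+ 2 - 1) * (1 + x * (x ^+ m) ^+ 2) * R j.*2.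
Proof.
rewrite (zcountS m q_gt1) zcount_step_odd (rcountS m q_gt1) odd_double exp_even exp_odd.
by ring.
Qed.

(** [X] and [E] are the two exponential solutions, with ratios [q^(n-2)] and [q^((n-1)/2)] for
    [n = 2m + 3]. The factor on the left clears the denominator [q^(n-2) - q], and both identities
    are proved by a joint induction. *)
Lemma zcount_even j :
  let: a := x ^+ m in let: X := (x * a ^+ 2) ^+ j.*2 in let: E := (a * x) ^+ j.*2 in
  (x * a ^+ 2 - x) * R j.*2 = (x * a ^+ 2 - 1) * X - (x - 1) * E /\
  (x * a ^+ 2 - x) * N j.*2 =
     (x ^+ 2 * a ^+ 2 - 1) * X - (x - 1) * (x * a ^+ 2 + 1) * E.
Proof.
elim: j => [|j [IHR IHN]]; first by rewrite /= !expr0; split; ring.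
rewrite doubleS rcount_step_even zcount_step_even !(exprS (x * _ ^+ 2)) !(exprS (_ * x)).
move: IHR IHN; set a := x ^+ m; set X := _ ^+ j.*2; set E := (a * x) ^+ j.*2.
move=> IHR IHN; split; rewrite mulrDr.
  by rewrite [X in X + _]mulrCA IHR; ring.
by rewrite [X in _ + X]mulrCA IHR IHN; ring.
Qed.

Lemma zcount_odd j :
  let: a := x ^+ m in let: X := (x * a ^+ 2) ^+ j.*2 in let: E := (a * x) ^+ j.*2 in
  (x * a ^+ 2 - x) * N j.*2.+1 =
     (x ^+ 2 * a ^+ 2 - 1) * X * (x * a ^+ 2) - (x ^+ 2 - 1) * a * E * (a * x).
Proof.
have [IHR IHN] := zcount_even j.
by rewrite zcount_step_odd mulrDr IHN [X in _ + X]mulrCA IHR; ring.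
Qed.

End StepTwo.

(** * The ternary case, where the two exponentials coincide *)

Section Ternary.
Variable q : nat.
Hypothesis q_gt1 : (1 < q)%N.
Local Notation x := (q%:R : rat).
Local Notation R d := ((rcount q 0 d)%:R : rat).
Local Notation N d := ((zcount q 0 d)%:R : rat).

(** For [m = 0] the factor used in [zcount_even] is zero and both exponentials equal [x ^+ j.*2];
    this resonance produces the term linear in [j]. *)
Lemma zcount0_even j :
  x * R j.*2 = x ^+ j.*2 * (x + j%:R * (x - 1)) /\
  x * N j.*2 = x ^+ j.*2 * (x + j%:R * (x ^+ 2 - 1)).
Proof.
elim: j => [|j [IHR IHN]]; first by rewrite /= !expr0; split; ring.
rewrite doubleS (rcount_step_even 0 q_gt1) (zcount_step_even 0 q_gt1).
rewrite !expr0 !expr1n !mul1r !mulr1 !exprS -natr1.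
split; rewrite mulrDr.
  by rewrite [X in X + _]mulrCA IHR; ring.
by rewrite [X in _ + X]mulrCA IHR IHN; ring.
Qed.

Lemma zcount0_odd j :
  x * N j.*2.+1 = x ^+ j.*2 * (x ^+ 3 + j%:R * (x ^+ 2 - 1) * x).
Proof.
have [IHR IHN] := zcount0_even j.
rewrite (zcount_step_odd 0 q_gt1) expr0 expr1n mulr1 mulrDr [X in _ + X]mulrCA IHR IHN.
by ring.
Qed.

End Ternary.

Theorem theorem5p8 (F : finFieldType) (n : nat) (a : 'I_n -> F) (P : nat) :
  odd #|F| -> odd n -> (3 <= n)%N -> (forall i, a i != 0) -> (1 <= P)%N ->
  let q : rat := #|F|%:R in
  (NP a P)%:R =
  (if n == 3%N then
     if ~~ odd P then
       (q ^+ 2 - 1) / (2 * q) * P%:R * q ^+ P + q ^+ P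
     else
       (q ^+ 2 - 1) / (2 * q) * P%:R * q ^+ P + (q ^+ 2 + 1) / (2 * q) * q ^+ P
   else
     if ~~ odd P then
       (q ^+ n.-1 - 1) / (q ^+ (n - 2) - q) * q ^+ (P * (n - 2))
       - (q - 1) * (q ^+ (n - 2) + 1) / (q ^+ (n - 2) - q) * q ^+ ((n.-1)./2 * P)
     else
       (q ^+ n.-1 - 1) / (q ^+ (n - 2) - q) * q ^+ (P * (n - 2))
       - (q ^+ 2 - 1) * q ^+ ((n - 3)./2) / (q ^+ (n - 2) - q) * q ^+ ((n.-1)./2 * P)).
Proof.
move=> F_odd n_odd n3 a0 _ q.
have [m En] : exists m, n = m.+1.*2.+1 by exists (n.-2)./2; lia.
subst n; rewrite (NP_zcount F_odd _ a0).
have q1 : (1 < #|F|)%N := finNzRing_gt1 F.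
have q0 : q != 0 by rewrite pnatr_eq0 -lt0n ltnW.
have P2 : P = ((P./2).*2 + odd P)%N by rewrite addnC odd_double_half.
case: m a {a0 n_odd n3} => [|m] _ /=.
  rewrite P2; move: (P./2) (odd P) => j b; rewrite oddD odd_double /= oddb.
  have Ej : j.*2%:R = j%:R * 2 :> rat by rewrite -muln2 natrM.
  apply: (mulfI q0); case: b => /=.
    rewrite addn1 (zcount0_odd q1) -/q (exprS q j.*2) -(natr1 j.*2) Ej; field.
    by rewrite q0.
  rewrite addn0 (zcount0_even q1 _).2 -/q Ej; field.
  by rewrite q0.
have -> : (m.+2.*2.+1 - 2 = m.+1.*2.+1)%N by lia.
rewrite doubleK.
(* After the case split [m] has dropped by one, so [y] is the quantity [a] of [zcount_even]. *)
pose y := q ^+ m.+1.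
have Ey : q ^+ m.+1.*2.+1 = q * y ^+ 2 by rewrite exprS -muln2 exprM.
have Ez : q ^+ m.+2.*2 = q ^+ 2 * y ^+ 2 by rewrite -exprMn -exprS -exprM muln2.
(* For [n >= 5] the exponent of [y] is positive, so [y ^+ 2 > 1] and the common denominator is
   nonzero. *)
have D0 : q * y ^+ 2 - q != 0.
  rewrite -[X in _ - X]mulr1 -mulrBr mulf_neq0 // subr_eq0 Order.POrderTheory.gt_eqF //.
  by rewrite !exprn_egt1 // ltr1n.
rewrite Ez (mulnC P) !exprM Ey [q ^+ m.+2]exprSr -/y.
rewrite P2; move: (P./2) (odd P) => j b; rewrite oddD odd_double /= oddb.
apply: (mulfI D0); case: b => /=.
  rewrite addn1 (zcount_odd _ q1) -/q -/y !exprS; field.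
  by rewrite D0.
rewrite addn0 (zcount_even _ q1 _).2 -/q -/y; field.
by rewrite D0.
Qed.
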